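(* Let $M$ be a closed hyperbolic $3$-manifold. Then no nontrivial harmonic $1$-form $\alpha$ on $M$ has constant length (i.e. the pointwise norm $|\alpha_p|$ is not constant in $p\in M$).
   Context: All manifolds are oriented. A harmonic $1$-form on $M$ is a smooth $1$-form $\alpha$ with $d\alpha=d^*\alpha=0$; nontrivial means not identically zero. *)

(* Defs.v *)
From mathcomp Require Export all_boot all_order all_algebra.
From mathcomp Require Export all_classical all_reals all_analysis.
Export Order.TTheory GRing.Theory Num.Theory.
Export numFieldNormedType.Exports.

Set Implicit Arguments.
Unset Strict Implicit.
Unset Printing Implicit Defensive.

Local Open Scope classical_set_scope.
Local Open Scope ring_scope.

Section Smoothness.
Variables (R : realType) (n : nat).
Implicit Types (U : set 'rV[R]_n) (f : 'rV[R]_n -> R).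

Definition partial (i : 'I_n) f (x : 'rV[R]_n) : R := 'D_(delta_mx 0 i) f x.

(* U is meant to be open: continuity and derivability are taken in the ambient
   space, not relatively to U. *)
Fixpoint Ck (k : nat) U f : Prop :=
  {in U, continuous f} /\
  if k is k'.+1 then
    forall i : 'I_n, {in U, forall x, derivable f x (delta_mx 0 i)} /\
                     Ck k' U (partial i f)
  else True.

Definition smooth U f : Prop := forall k, Ck k U f.

Definition smooth_map m U (F : 'rV[R]_n -> 'rV[R]_m) : Prop :=
  forall j, smooth U (fun x => F x 0 j).

End Smoothness.

(* The values of cfun outside cdom, and of cinv outside cfun @` cdom, carry no
   information. *)
Record chart (R : realType) (n : nat) (M : topologicalType) := Chart {
  cdom : set M;
  cfun :> M -> 'rV[R]_n;
  cinv : 'rV[R]_n -> M;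
  cdom_open : open cdom;
  cran_open : open (cfun @` cdom);
  cfunK : {in cdom, cancel cfun cinv};
  cfun_continuous : {in cdom, continuous cfun};
  cinv_continuous : {in cfun @` cdom, continuous cinv}
}.

Section Charts.
Variables (R : realType) (n : nat) (M : topologicalType).
Implicit Types c : chart R n M.

Definition cran c : set 'rV[R]_n := c @` cdom c.

Definition transition c c' (x : 'rV[R]_n) : 'rV[R]_n := c' (cinv c x).

(* With the row-vector convention of [jacobian], writing x for the coordinates
   of c and y for those of c', the (i, j) entry is dy^j / dx^i. *)
Definition transition_jacobian c c' (p : M) : 'M[R]_n :=
  jacobian (transition c c') (c p).

Definition oriented_compatible c c' : Prop :=
  smooth_map (c @` (cdom c `&` cdom c')) (transition c c') /\
  forall p, cdom c p -> cdom c' p -> 0 < \det (transition_jacobian c c' p).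

(* Reads in the coordinates of c a function given on the domain of c. *)
Definition in_coord T c (f : M -> T) (x : 'rV[R]_n) : T := f (cinv c x).

End Charts.

(* The oriented smooth structure is a maximal oriented atlas. *)
Record oriented_manifold (R : realType) (n : nat) := OrientedManifold {
  carrier :> topologicalType;
  atlas : set (chart R n carrier);
  carrier_hausdorff : hausdorff_space carrier;
  carrier_second_countable : @second_countable carrier;
  atlas_cover : forall p : carrier, exists2 c, atlas c & cdom c p;
  atlas_compatible : forall c c', atlas c -> atlas c' ->
    oriented_compatible c c';
  atlas_maximal : forall c,
    (forall c', atlas c' ->
       oriented_compatible c c' /\ oriented_compatible c' c) -> atlas c
}.

(* Charts take values in open subsets of R^n, so there is no boundary. *)
Definition closed_manifold R n (M : oriented_manifold R n) : Prop :=
  compact [set: M].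

(* Tensor fields are given by their components: [metric_at g c p] and
   [form_at a c p] hold the components at p in the coordinates of c (a covector
   is a column); they are relevant only for c in the atlas and p in the domain
   of c. *)
Record riemannian_metric (R : realType) (n : nat) (M : oriented_manifold R n) :=
  RiemannianMetric {
  metric_at : chart R n M -> M -> 'M[R]_n;
  metric_smooth : forall c, atlas c -> forall i j,
    smooth (cran c) (fun x => in_coord c (metric_at c) x i j);
  metric_sym : forall c, atlas c -> forall p, cdom c p ->
    (metric_at c p)^T = metric_at c p;
  metric_posdef : forall c, atlas c -> forall p, cdom c p ->
    forall v : 'rV[R]_n, v != 0 -> 0 < (v *m metric_at c p *m v^T) 0 0;
  metric_transform : forall c c', atlas c -> atlas c' ->
    forall p, cdom c p -> cdom c' p ->
    let J := transition_jacobian c c' p in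
    metric_at c p = J *m metric_at c' p *m J^T
}.

Record one_form (R : realType) (n : nat) (M : oriented_manifold R n) :=
  OneForm {
  form_at : chart R n M -> M -> 'cV[R]_n;
  form_smooth : forall c, atlas c -> forall i,
    smooth (cran c) (fun x => in_coord c (form_at c) x i 0);
  form_transform : forall c c', atlas c -> atlas c' ->
    forall p, cdom c p -> cdom c' p ->
    form_at c p = transition_jacobian c c' p *m form_at c' p
}.

Section Harmonic.
Variables (R : realType) (n : nat) (M : oriented_manifold R n).
Variables (g : riemannian_metric M) (a : one_form M).

(* The coefficient of dx^i /\ dx^j (i < j) in d a. *)
Definition ext_deriv (c : chart R n M) (i j : 'I_n) (x : 'rV[R]_n) : R :=
  partial i (fun y => in_coord c (form_at a c) y j 0) x
  - partial j (fun y => in_coord c (form_at a c) y i 0) x.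

(* d^* a = - div a^# = - |g|^(-1/2) d_i (|g|^(1/2) g^(ij) a_j). *)
Definition codiff (c : chart R n M) (x : 'rV[R]_n) : R :=
  let sqrtg y := Num.sqrt (\det (in_coord c (metric_at g c) y)) in
  let sharp y := invmx (in_coord c (metric_at g c) y)
                 *m in_coord c (form_at a c) y in
  - ((sqrtg x)^-1 * \sum_i partial i (fun y => sqrtg y * sharp y i 0) x).

Definition harmonic : Prop :=
  forall c, atlas c -> forall x, cran c x ->
    (forall i j, ext_deriv c i j x = 0) /\ codiff c x = 0.

Definition nontrivial : Prop :=
  exists c p, [/\ atlas c, cdom c p & form_at a c p != 0].

Definition pointwise_norm (c : chart R n M) (p : M) : R :=
  Num.sqrt (((form_at a c p)^T *m invmx (metric_at g c p) *m form_at a c p) 0 0).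

Definition constant_length : Prop :=
  exists k : R, forall c p, atlas c -> cdom c p -> pointwise_norm c p = k.

End Harmonic.

Section Hyperbolic.
Variables (R : realType) (n : nat).

(* Upper half-space model of hyperbolic (n+1)-space. *)
Definition half_space : set 'rV[R]_n.+1 := [set x | 0 < x 0 ord_max].

Definition half_space_metric (x : 'rV[R]_n.+1) : 'M[R]_n.+1 :=
  ((x 0 ord_max) ^- 2)%:M.

(* Every point has an open neighbourhood isometric to an open subset of
   hyperbolic space.  Since the atlas is maximal, a chart in it is the same as
   an orientation-preserving diffeomorphism from an open subset of M onto an
   open subset of R^(n+1); requiring the isometry to preserve orientation loses
   nothing, as hyperbolic space has orientation-reversing isometries. *)
Definition hyperbolic (M : oriented_manifold R n.+1) (g : riemannian_metric M) :
    Prop :=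
  forall p : M, exists c, [/\ atlas c, cdom c p, cran c `<=` half_space &
    forall q, cdom c q -> metric_at g c q = half_space_metric (c q)].

End Hyperbolic.

(* Main.v *)
Require Import Defs.
From HB Require Import structures.
From mathcomp Require Import ring lra.

(* The obstruction is local. Let b be closed and coclosed with |b|^2 = k > 0 on an
   open subset of hyperbolic 3-space. Its covariant derivative B is symmetric and
   traceless, and differentiating |b|^2 = k gives B b = 0. Bochner's formula yields
   |B|^2 = 2k, so B has eigenvalues 0, sqrt k, -sqrt k, i.e. B^2 = k Id - b b^T.
   Differentiating this identity and using Codazzi's equation determines the
   covariant derivative of B as a polynomial in b and B. The resulting first-order
   system for (b, B) is not integrable: the Ricci identity for B, contracted once,
   reads 3 k B = k B, contradicting |B|^2 = 2k.
   (Geometrically, the leaves of ker b would be surfaces with constant principal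
   curvatures 1 and -1, which would have to be flat, whereas the Gauss equation
   gives them curvature -2.) *)

Set Implicit Arguments.
Unset Strict Implicit.
Unset Printing Implicit Defensive.

Local Open Scope classical_set_scope.
Local Open Scope ring_scope.

(** * Smooth functions on open subsets of R^n *)

Section SmoothCalculus.
Variables (R : realType) (n : nat) (U : set 'rV[R]_n).
Hypothesis Uo : open U.
Implicit Types (f g : 'rV[R]_n -> R) (i j : 'I_n) (x : 'rV[R]_n) (a : R).

Lemma near_eq_on f g x : (forall y, U y -> f y = g y) -> U x ->
  \forall y \near x, f y = g y.
Proof. by move=> fg Ux; near do apply: fg; exact: open_nbhs_nbhs.
Unshelve. all: by end_near. Qed.

Lemma partial_eq_on f g i x : (forall y, U y -> f y = g y) -> U x ->
  partial i f x = partial i g x.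
Proof. by move=> fg Ux; apply: near_eq_derive; exact: near_eq_on. Qed.

Lemma continuous_eq_on f g : (forall y, U y -> f y = g y) ->
  {in U, continuous f} -> {in U, continuous g}.
Proof.
move=> fg fc x xU; have Ux : U x by rewrite inE in xU.
rewrite /continuous_at -(fg _ Ux).
exact: cvg_trans (@near_eq_cvg _ _ (nbhs x) _ f g (near_eq_on fg Ux)) (fc _ xU).
Qed.

(** Derivatives at a point of the open set [U] only see values near that point. This lets an
    iterated partial derivative be replaced by the formula that a differentiation rule gives for it
    on [U]. *)
Lemma Ck_eq_on k f g : (forall y, U y -> f y = g y) -> Ck k U f -> Ck k U g.
Proof.
elim: k f g => [|k IH] f g fg [fc fd].
  by split=> //; exact: continuous_eq_on fc.
split; first exact: continuous_eq_on fc.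
move=> i; have [fdi fCi] := fd i; split.
- move=> x xU; apply: near_eq_derivable (fdi _ xU).
  by apply: near_eq_on => //; rewrite inE in xU.
- by apply: IH fCi => y Uy; exact: partial_eq_on.
Qed.

Lemma CkW k f : Ck k.+1 U f -> Ck k U f.
Proof.
elim: k f => [|k IH] f [fc fd]; split=> // i.
by have [? ?] := fd i; split=> //; exact: IH.
Qed.

Lemma Ck_cst k a : Ck k U (fun=> a).
Proof.
elim: k a => [|k IH] a; split=> //; try by move=> x _; exact: cst_continuous.
move=> i; split; first by move=> x _; exact: derivable_cst.
by apply: Ck_eq_on (IH 0) => y _; rewrite /partial derive_cst.
Qed.

Lemma CkD k f g : Ck k U f -> Ck k U g -> Ck k U (fun x => f x + g x).
Proof.
elim: k f g => [|k IH] f g [fc fd] [gc gd]; split=> //.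
1,2: by move=> x xU; apply: continuousD; [exact: fc|exact: gc].
move=> i; have [[fdi fCi] [gdi gCi]] := (fd i, gd i); split.
  by move=> x xU; apply: derivableD; [exact: fdi|exact: gdi].
apply: Ck_eq_on (IH _ _ fCi gCi) => y /mem_set yU.
by rewrite /partial deriveD//; [exact: fdi|exact: gdi].
Qed.

Lemma CkM k f g : Ck k U f -> Ck k U g -> Ck k U (fun x => f x * g x).
Proof.
elim: k f g => [|k IH] f g Cf Cg; have [[fc fd] [gc gd]] := (Cf, Cg); split=> //.
1,2: by move=> x xU; apply: continuousM; [exact: fc|exact: gc].
move=> i; have [[fdi fCi] [gdi gCi]] := (fd i, gd i); split.
  by move=> x xU; apply: derivableM; [exact: fdi|exact: gdi].
(* In the Leibniz rule each factor also occurs undifferentiated, so its order is lowered to match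
   that of the partial derivative. *)
have := CkD (IH _ _ (CkW Cf) gCi) (IH _ _ (CkW Cg) fCi).
apply: Ck_eq_on => y /mem_set yU.
by rewrite /partial deriveM//; [exact: fdi|exact: gdi].
Qed.

Lemma is_derive_coord j x (v : 'rV[R]_n) :
  is_derive x v (fun y : 'rV[R]_n => y 0 j) (v 0 j).
Proof.
suff H : (fun h => h^-1 *: (((fun y : 'rV[R]_n => y 0 j) \o shift x) (h *: v)
    - x 0 j)) @ 0^' --> v 0 j.
  by apply: DeriveDef; [apply/cvg_ex; exists (v 0 j)|exact: cvg_lim H].
have -> : (fun h => h^-1 *: (((fun y : 'rV[R]_n => y 0 j) \o shift x) (h *: v)
    - x 0 j))
  = (fun h : R => h^-1 * h * v 0 j).
  by apply/funext => h /=; rewrite !mxE addrK scalerA.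
apply: cvg_near_cst; exists 1 => //= h _ h0.
by rewrite mulVf ?mul1r.
Qed.

Lemma Ck_coord k j : Ck k U (fun x => x 0 j).
Proof.
case: k => [|k]; split=> //; try by move=> x _; exact: coord_continuous.
move=> i; split; first by move=> x _; have [] := is_derive_coord j x (delta_mx 0 i).
apply: Ck_eq_on (Ck_cst k ((i == j)%:R)) => y _.
by rewrite /partial (@derive_val _ _ _ _ _ _ _ (is_derive_coord _ _ _)) mxE eqxx eq_sym.
Qed.

Lemma smooth_eq_on f g : (forall y, U y -> f y = g y) -> smooth U f -> smooth U g.
Proof. by move=> fg sf k; exact: Ck_eq_on (sf k). Qed.

Lemma smooth_cst a : smooth U (fun=> a).
Proof. by move=> k; exact: Ck_cst. Qed.

Lemma smooth_coord j : smooth U (fun x => x 0 j).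
Proof. by move=> k; exact: Ck_coord. Qed.

Lemma smoothD f g : smooth U f -> smooth U g -> smooth U (fun x => f x + g x).
Proof. by move=> sf sg k; exact: CkD. Qed.

Lemma smoothM f g : smooth U f -> smooth U g -> smooth U (fun x => f x * g x).
Proof. by move=> sf sg k; exact: CkM. Qed.

Lemma smoothN f : smooth U f -> smooth U (fun x => - f x).
Proof.
move=> sf; have := smoothM (smooth_cst (-1)) sf.
by apply: smooth_eq_on => y _; rewrite mulN1r.
Qed.

Lemma smoothB f g : smooth U f -> smooth U g -> smooth U (fun x => f x - g x).
Proof. by move=> sf sg; apply: smoothD => //; exact: smoothN. Qed.

Lemma smooth_derivable f i x : smooth U f -> U x -> derivable f x (delta_mx 0 i).
Proof. by move=> /(_ 1%N)[_ /(_ i)[fd _]] Ux; apply: fd; rewrite inE. Qed.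

Lemma smooth_partial f i : smooth U f -> smooth U (partial i f).
Proof. by move=> sf k; have [_ /(_ i)[]] := sf k.+1. Qed.

Lemma smooth_continuous f x : smooth U f -> U x -> {for x, continuous f}.
Proof. by move=> /(_ 0%N)[fc _] Ux; apply: fc; rewrite inE. Qed.

Lemma partial_cst a i x : partial i (fun=> a) x = 0.
Proof. exact: derive_cst. Qed.

Lemma partial_coord i j x : partial i (fun y => y 0 j) x = (j == i)%:R.
Proof.
by rewrite /partial (@derive_val _ _ _ _ _ _ _ (is_derive_coord _ _ _)) mxE eqxx.
Qed.

Lemma partialD f g i x : smooth U f -> smooth U g -> U x ->
  partial i (fun y => f y + g y) x = partial i f x + partial i g x.
Proof. by move=> sf sg Ux; apply: deriveD; exact: smooth_derivable. Qed.

Lemma partialM f g i x : smooth U f -> smooth U g -> U x ->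
  partial i (fun y => f y * g y) x = f x * partial i g x + g x * partial i f x.
Proof. by move=> sf sg Ux; apply: deriveM; exact: smooth_derivable. Qed.

Lemma partialB f g i x : smooth U f -> smooth U g -> U x ->
  partial i (fun y => f y - g y) x = partial i f x - partial i g x.
Proof. by move=> sf sg Ux; apply: deriveB; exact: smooth_derivable. Qed.

Lemma partial_sum (I : finType) (f : I -> 'rV[R]_n -> R) i x :
  (forall m, smooth U (f m)) -> U x ->
  partial i (fun y => \sum_m f m y) x = \sum_m partial i (f m) x.
Proof.
move=> sf Ux.
have sfs (s : seq I) : smooth U (fun y => \sum_(m <- s) f m y).
  elim: s => [|m s IH].
    by apply: smooth_eq_on (smooth_cst 0) => y _; rewrite big_nil.
  by apply: smooth_eq_on (smoothD (sf m) IH) => y _; rewrite big_cons.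
elim: (index_enum I) => [|m s IH].
  rewrite big_nil -[RHS](partial_cst 0 i x); apply: partial_eq_on => // y _.
  by rewrite big_nil.
rewrite big_cons -IH -partialD //; apply: partial_eq_on => // y _.
by rewrite big_cons.
Qed.

(** * Symmetry of second partial derivatives *)

Lemma is_derive_line f (x v : 'rV[R]_n) (t : R) :
  derivable f (x + t *: v) v ->
  is_derive t 1 (fun s => f (x + s *: v)) ('D_v f (x + t *: v)).
Proof.
have E : (fun h : R => h^-1 *:
    (((fun s : R => f (x + s *: v)) \o shift t) (h *: 1) - f (x + t *: v)))
  = (fun h : R => h^-1 *: ((f \o shift (x + t *: v)) (h *: v) - f (x + t *: v))).
  apply/funext => h /=; congr (_ *: (f _ - _)).
  by rewrite [h *: 1]mulr1 scalerDl addrCA.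
by move=> fd; apply: DeriveDef; rewrite /derivable /derive E.
Qed.

(** Two uses of the mean value theorem: first for the difference of [f] along two parallel edges in
    direction [i], then for [partial i f] in direction [j]. The second difference is symmetric in
    [i] and [j], which is what [partialC] exploits. *)
Lemma second_difference f i j x (s : R) : smooth U f -> 0 < s ->
  (forall c d, 0 <= c <= s -> 0 <= d <= s ->
     U (x + c *: delta_mx 0 i + d *: delta_mx 0 j)) ->
  exists c d, [/\ 0 <= c <= s, 0 <= d <= s &
    f (x + s *: delta_mx 0 i + s *: delta_mx 0 j) - f (x + s *: delta_mx 0 i)
    - (f (x + s *: delta_mx 0 j) - f x)
    = s * s * partial j (partial i f)
        (x + c *: delta_mx 0 i + d *: delta_mx 0 j)].
Proof.
move=> sf s0 box; set u := delta_mx 0 i; set v := delta_mx 0 j.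
have s_in : 0 <= s <= s by apply/andP; split=> //; exact: ltW.
have z_in : 0 <= (0 : R) <= s by apply/andP; split=> //; exact: ltW.
have h' c : 0 <= c <= s -> is_derive c (1 : R)
    (fun t => f (x + s *: v + t *: u) - f (x + t *: u))
    (partial i f (x + s *: v + c *: u) - partial i f (x + c *: u)).
  move=> cs; apply: is_deriveB; apply: is_derive_line; apply: smooth_derivable => //.
    by rewrite addrAC; exact: box.
  by have := box c 0 cs z_in; rewrite scale0r addr0.
have [||c cs] := @MVT R (fun t => f (x + s *: v + t *: u) - f (x + t *: u))
  (fun c => partial i f (x + s *: v + c *: u) - partial i f (x + c *: u)) _ _ s0.
- by move=> c; rewrite in_itv /= => /andP[/ltW c0 /ltW c1]; apply: h'; rewrite c0.
- apply: derivable_within_continuous => c; rewrite in_itv /= => cs.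
  by have [] := h' c cs.
have {}cs : 0 <= c <= s by move: cs; rewrite in_itv /= => /andP[/ltW -> /ltW ->].
rewrite scale0r !addr0 subr0 => Ec.
have k' d : 0 <= d <= s -> is_derive d (1 : R)
    (fun t => partial i f (x + c *: u + t *: v))
    (partial j (partial i f) (x + c *: u + d *: v)).
  move=> ds; apply: is_derive_line; apply: smooth_derivable; last exact: box.
  exact: smooth_partial.
have [||d ds] := @MVT R (fun t => partial i f (x + c *: u + t *: v))
  (fun d => partial j (partial i f) (x + c *: u + d *: v)) _ _ s0.
- by move=> d; rewrite in_itv /= => /andP[/ltW c0 /ltW c1]; apply: k'; rewrite c0.
- apply: derivable_within_continuous => d; rewrite in_itv /= => ds.
  by have [] := k' d ds.
have {}ds : 0 <= d <= s by move: ds; rewrite in_itv /= => /andP[/ltW -> /ltW ->].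
rewrite scale0r !addr0 subr0 => Ed.
exists c, d; split=> //.
move: Ec; rewrite [x + s *: v + c *: u]addrAC Ed [x + s *: v + s *: u]addrAC.
by move=> E; rewrite opprB addrA in E *; lra.
Qed.

(** Balls are taken in the sup norm. If [i = j] the two increments add up, and their sum is still
    below [r]. *)
Lemma ball_rectangle x (r c d : R) i j : 0 < r ->
  0 <= c <= r / 4 -> 0 <= d <= r / 4 ->
  ball x r (x + c *: delta_mx 0 i + d *: delta_mx 0 j).
Proof.
move=> r0 hc hd; have cd : 0 <= c + d < r by lra.
have [cr dr] : 0 <= c < r /\ 0 <= d < r by lra.
split=> // p q; rewrite /ball /= !mxE opprD addrA opprD addrA subrr sub0r.
rewrite -opprD normrN.
move: cd cr dr => /andP[? ?] /andP[? ?] /andP[? ?].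
by case: (_ && _); case: (_ && _);
  rewrite ?mulr1 ?mulr0 ?addr0 ?add0r ?normr0 // ger0_norm.
Qed.

Lemma partialC f i j x : smooth U f -> U x ->
  partial j (partial i f) x = partial i (partial j f) x.
Proof.
move=> sf Ux; apply/eqP/negPn/negP => neq.
set a := partial j (partial i f); set b := partial i (partial j f).
(* Half the supposed gap: if [a] and [b] both stay within [e] of their values at [x], they cannot
   take a common value nearby. *)
pose e := `|a x - b x| / 2.
have e0 : 0 < e by rewrite divr_gt0 // normr_gt0 subr_eq0.
have ca : {for x, continuous a}.
  by apply: smooth_continuous Ux; do 2!apply: smooth_partial.
have cb : {for x, continuous b}.
  by apply: smooth_continuous Ux; do 2!apply: smooth_partial.
have na : \forall y \near nbhs x, `|a x - a y| < e.
  exact: (@cvgr_dist_lt _ _ _ (nbhs x) _ _ _ ca).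
have nb : \forall y \near nbhs x, `|b x - b y| < e.
  exact: (@cvgr_dist_lt _ _ _ (nbhs x) _ _ _ cb).
have nU : nbhs x U by exact: open_nbhs_nbhs.
have [r /= r0 Hr] := (nbhs_ballP _ _).1 (filterI nU (filterI na nb)).
have s0 : 0 < r / 4 by rewrite divr_gt0.
have [c [d [hc hd Ea]]] := second_difference sf s0
  (fun c d hc hd => (Hr _ (ball_rectangle x i j r0 hc hd)).1).
have [c' [d' [hc' hd' Eb]]] := second_difference sf s0
  (fun c d hc hd => (Hr _ (ball_rectangle x j i r0 hc hd)).1).
have [_ [ha _]] := Hr _ (ball_rectangle x i j r0 hc hd).
have [_ [_ hb]] := Hr _ (ball_rectangle x j i r0 hc' hd').
rewrite -/a -/b in Ea Eb.
(* Both values, times the square of the side, equal the same second difference. *)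
have E : a (x + c *: delta_mx 0 i + d *: delta_mx 0 j)
     = b (x + c' *: delta_mx 0 j + d' *: delta_mx 0 i).
  clearbody a b; have ss : r / 4 * (r / 4) != 0 by rewrite mulf_neq0 // lt0r_neq0.
  apply: (mulfI ss); move: Ea Eb.
  move: (a _) (b _) => va vb.
  rewrite [x + _ *: delta_mx 0 j + _]addrAC => <- <-; ring.
rewrite E in ha.
have : `|a x - b x| < e + e.
  move: ha hb; move: (b (_ + _)) (a x) (b x) => w u v hu hv.
  rewrite (_ : u - v = (u - w) - (v - w)); last by ring.
  by apply: le_lt_trans (ler_normB _ _) _; rewrite ltrD.
by rewrite -mulr2n -mulr_natr divfK ?ltxx // pnatr_eq0.
Qed.

End SmoothCalculus.

(** * Pointwise tensor algebra *)

Local Notation mid := (lift ord0 ord0 : 'I_3).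

Lemma sum_ord3 (V : zmodType) (F : 'I_3 -> V) :
  \sum_i F i = F ord0 + F mid + F ord_max.
Proof.
rewrite !big_ord_recl big_ord0 addr0 addrA; congr (_ + F _).
exact: val_inj.
Qed.

Section TensorAlgebra.
Variable R : realFieldType.

Lemma sum_delta n (l : 'I_n) (F : 'I_n -> R) : \sum_i (l == i)%:R * F i = F l.
Proof.
rewrite (bigD1 l) //= eqxx mul1r big1 ?addr0 // => i il.
by rewrite eq_sym (negbTE il) mul0r.
Qed.

(* The difference N of the two sides has squared norm 0, because a traceless
   symmetric 3 x 3 matrix satisfies 2 tr B^4 = (tr B^2)^2. *)
Lemma traceless_sqr_mx3 (k : R) (b : 'I_3 -> R) (B : 'I_3 -> 'I_3 -> R) :
  (forall i j, B i j = B j i) -> \sum_i B i i = 0 ->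
  (forall i, \sum_j B i j * b j = 0) -> \sum_i b i * b i = k ->
  \sum_i \sum_j B i j * B i j = 2 * k ->
  forall i j, \sum_l B i l * B l j = k * (i == j)%:R - b i * b j.
Proof.
move=> Bsym trB Bb bb BB.
pose N i j := \sum_l B i l * B l j - k * (i == j)%:R + b i * b j.
suff N0 : \sum_i \sum_j N i j ^+ 2 = 0.
  move=> i j; apply/eqP; rewrite -subr_eq0 opprB addrA addrAC -/(N i j).
  rewrite -sqrf_eq0; move/eqP: N0; rewrite psumr_eq0; last first.
    by move=> m _; apply: sumr_ge0 => p _; exact: sqr_ge0.
  move=> /allP /(_ i); rewrite mem_index_enum => /(_ isT) /=.
  rewrite psumr_eq0; last by move=> p _; exact: sqr_ge0.
  by move=> /allP /(_ j); rewrite mem_index_enum => /(_ isT) /=.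
pose S i j := \sum_l B i l * B l j.
have trS : \sum_i S i i = 2 * k.
  rewrite -BB; apply: eq_bigr => i _; apply: eq_bigr => j _.
  by rewrite (Bsym j).
have Sb : \sum_i \sum_j S i j * b i * b j = 0.
  rewrite big1 // => i _; rewrite -[RHS](mul0r (b i)).
  transitivity ((\sum_l B i l * \sum_j B l j * b j) * b i); last first.
    by rewrite big1 ?mul0r // => l _; rewrite Bb mulr0.
  rewrite /S; under [in RHS]eq_bigr do rewrite mulr_sumr.
  rewrite exchange_big mulr_suml; apply: eq_bigr => j _ /=.
  rewrite -mulrA !mulr_suml; apply: eq_bigr => l _; ring.
have S2 : 2 * (\sum_i \sum_j S i j ^+ 2) = (\sum_i S i i) ^+ 2.
  (* Eliminating one diagonal entry through the trace leaves a polynomial identity in five free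
     entries. *)
  have B22 : B ord_max ord_max = - B ord0 ord0 - B mid mid.
    by move: trB; rewrite sum_ord3; lra.
  rewrite /S !sum_ord3 (Bsym mid ord0) (Bsym ord_max ord0) (Bsym ord_max mid) B22.
  by move: (B _ _) (B _ _) (B _ _) (B _ _) (B _ _) => u v w x y; ring.
have -> : \sum_i \sum_j N i j ^+ 2 =
    \sum_i \sum_j S i j ^+ 2 + 3 * k ^+ 2 + (\sum_i b i * b i) ^+ 2
    - 2 * k * (\sum_i S i i) + 2 * (\sum_i \sum_j S i j * b i * b j)
    - 2 * k * (\sum_i b i * b i).
  transitivity (\sum_i \sum_j (S i j - k * (i == j)%:R + b i * b j) ^+ 2) => //.
  rewrite !sum_ord3 !eqxx.
  rewrite (_ : ord0 == mid = false) // (_ : ord0 == ord_max = false) //.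
  rewrite (_ : mid == ord0 = false) // (_ : mid == ord_max = false) //.
  rewrite (_ : ord_max == ord0 = false) // (_ : ord_max == mid = false) //=.
  ring.
(* Here [|S|^2 = 2 k^2], and the expansion reads [2 k^2 + 3 k^2 + k^2 - 4 k^2 + 0 - 2 k^2 = 0]. *)
by move: S2; rewrite Sb trS bb; lra.
Qed.

(** Alternating the two symmetries six times runs through all permutations of the indices and
    returns to [T i j k] after three sign changes. The same argument shows that a Levi-Civita
    connection is unique. *)
Lemma sym_skew_eq0 n (T : 'I_n -> 'I_n -> 'I_n -> R) :
  (forall i j k, T i j k = T j i k) -> (forall i j k, T i j k = - T i k j) ->
  forall i j k, T i j k = 0.
Proof.
move=> Ts Tk i j k.
have := Ts i j k; have := Tk j i k; have := Ts j k i; have := Tk k j i.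
by have := Ts k i j; have := Tk i k j; lra.
Qed.

(* The difference D of the two sides is totally symmetric and each D_l
   anticommutes with B, so D contracted with B is symmetric in its first two and
   skew in its last two indices, hence 0; multiplying by B again gives D = 0. *)
Lemma hessian_derivativeE n (k : R) (b : 'I_n -> R) (B : 'I_n -> 'I_n -> R)
    (C : 'I_n -> 'I_n -> 'I_n -> R) : k != 0 ->
  (forall i j, B i j = B j i) -> (forall i, \sum_j B i j * b j = 0) ->
  \sum_i b i * b i = k ->
  (forall i j, \sum_l B i l * B l j = k * (i == j)%:R - b i * b j) ->
  (forall l i j, C l i j = C l j i) ->
  (forall l i j, C l i j - C i l j = b l * (i == j)%:R - b i * (l == j)%:R) ->
  (forall l i, \sum_j C l i j * b j = - \sum_j B i j * B l j) ->
  (forall l i j, \sum_p (C l i p * B p j + B i p * C l p j)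
     = - (B l i * b j + b i * B l j)) ->
  forall l i j, k * C l i j = 2 * b l * b i * b j
    - k * (l == i)%:R * b j - k * (l == j)%:R * b i.
Proof.
move=> k0 Bsym Bb bb B2 Csym Codazzi Cb CB.
pose D l i j := k * C l i j + k * (l == i)%:R * b j + k * (l == j)%:R * b i
  - 2 * b l * b i * b j.
suff D0 l i j : D l i j = 0 by move=> l i j; have := D0 l i j; rewrite /D; lra.
(* This removes the rank-one part when [B^2] is replaced by [k Id - b b^T] in the last product. *)
have Db : \sum_p D l i p * b p = 0.
  transitivity (k * (\sum_p C l i p * b p)
     + (k * (l == i)%:R - 2 * b l * b i) * (\sum_p b p * b p)
     + k * b i * \sum_p (l == p)%:R * b p).
    rewrite !mulr_sumr -!big_split /=; apply: eq_bigr => p _; rewrite /D; ring.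
  rewrite Cb bb sum_delta.
  under eq_bigr do rewrite (Bsym l).
  by rewrite B2 (eq_sym i); ring.
pose T l i j := \sum_p D l i p * B p j.
have T0 : forall l i j, T l i j = 0.
  move=> {Db l i j}; apply: sym_skew_eq0 => l i j.
    apply: eq_bigr => p _; congr (_ * _).
    (* The correction terms in [D] are chosen so that Codazzi's equation becomes symmetry in the
       first two indices. *)
    have := Codazzi l i p; rewrite /D (eq_sym i l) => E.
    have {}E : C l i p = C i l p + (b l * (i == p)%:R - b i * (l == p)%:R) by lra.
    by rewrite E; ring.
  (* Skewness of [T] in its last two indices is [D_l B + B D_l = 0], which comes from the
     differentiated identity for [B^2]. *)
  apply/eqP; rewrite -addr_eq0; apply/eqP.
  transitivity (k * (\sum_p (C l i p * B p j + B i p * C l p j))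
     + (k * (l == i)%:R - 2 * b l * b i) * (\sum_p B j p * b p)
     + (k * (l == j)%:R - 2 * b l * b j) * (\sum_p B i p * b p)
     + k * b i * (\sum_p (l == p)%:R * B j p)
     + k * b j * (\sum_p (l == p)%:R * B i p)).
    rewrite !mulr_sumr -!big_split /=; apply: eq_bigr => p _.
    by rewrite /D (Csym l j p) (Bsym p i) (Bsym p j); ring.
  by rewrite CB !Bb !sum_delta (Bsym j) (Bsym i); ring.
have : \sum_p T l i p * B p j = k * D l i j.
  transitivity (k * (\sum_p (j == p)%:R * D l i p) - b j * (\sum_p D l i p * b p)).
    rewrite /T; under eq_bigr do rewrite mulr_suml.
    rewrite exchange_big /= !mulr_sumr -sumrB; apply: eq_bigr => p _.
    under eq_bigr do rewrite -mulrA.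
    by rewrite -mulr_sumr B2 (eq_sym j); ring.
  by rewrite sum_delta Db mulr0 subr0.
rewrite big1 => [/esym/eqP|p _]; last by rewrite T0 mul0r.
by rewrite mulf_eq0 (negbTE k0) => /eqP.
Qed.

End TensorAlgebra.

(** * The orthonormal frame of the half-space *)

(* The vector fields [z d_i] form an orthonormal frame of the half-space metric.
   The definition is locked because [ring] would otherwise unfold derivatives
   down to limits when comparing atoms. *)
HB.lock Definition hframe (R : realType) (n : nat) (z i : 'I_n)
  (f : 'rV[R]_n -> R) (x : 'rV[R]_n) : R := x 0 z * partial i f x.

Section HalfSpaceFrame.
Variables (R : realType) (n : nat) (U : set 'rV[R]_n) (z : 'I_n).
Hypothesis Uo : open U.
Implicit Types (f g : 'rV[R]_n -> R) (i j l m : 'I_n) (x : 'rV[R]_n).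

Local Notation frame := (hframe z).

Lemma frameE i f x : frame i f x = x 0 z * partial i f x.
Proof. by rewrite hframe.unlock. Qed.

Lemma smooth_frame i f : smooth U f -> smooth U (frame i f).
Proof.
move=> sf; rewrite hframe.unlock; apply: smoothM => //; first exact: smooth_coord.
exact: smooth_partial.
Qed.

Lemma frame_eq_on i f g x : (forall y, U y -> f y = g y) -> U x ->
  frame i f x = frame i g x.
Proof. by move=> fg Ux; rewrite !frameE (partial_eq_on Uo i fg Ux). Qed.

Lemma frame_cst i (a : R) x : frame i (fun=> a) x = 0.
Proof. by rewrite !frameE partial_cst mulr0. Qed.

Lemma frameD i f g x : smooth U f -> smooth U g -> U x ->
  frame i (fun y => f y + g y) x = frame i f x + frame i g x.
Proof. by move=> sf sg Ux; rewrite !frameE (partialD _ sf sg Ux) mulrDr. Qed.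

Lemma frameB i f g x : smooth U f -> smooth U g -> U x ->
  frame i (fun y => f y - g y) x = frame i f x - frame i g x.
Proof. by move=> sf sg Ux; rewrite !frameE (partialB _ sf sg Ux) mulrBr. Qed.

Lemma frameM i f g x : smooth U f -> smooth U g -> U x ->
  frame i (fun y => f y * g y) x = f x * frame i g x + g x * frame i f x.
Proof. by move=> sf sg Ux; rewrite !frameE (partialM _ sf sg Ux); ring. Qed.

Lemma frameZ i (a : R) f x : smooth U f -> U x ->
  frame i (fun y => a * f y) x = a * frame i f x.
Proof.
move=> sf Ux; rewrite frameM ?frame_cst ?mulr0 ?addr0 //; exact: smooth_cst.
Qed.

Lemma frame_sum (I : finType) (f : I -> 'rV[R]_n -> R) i x :
  (forall p, smooth U (f p)) -> U x ->
  frame i (fun y => \sum_p f p y) x = \sum_p frame i (f p) x.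
Proof.
move=> sf Ux; rewrite frameE (partial_sum Uo _ sf Ux) mulr_sumr.
by apply: eq_bigr => p _; rewrite frameE.
Qed.

(** Partial derivatives commute, so only the derivative of the height factor survives: [[E_i, E_j] =
    delta_iz E_j - delta_jz E_i]. *)
Lemma frame_bracket i j f x : smooth U f -> U x ->
  frame i (frame j f) x - frame j (frame i f) x
  = (i == z)%:R * frame j f x - (j == z)%:R * frame i f x.
Proof.
move=> sf Ux; have sc := smooth_coord Uo z.
have fE p : frame p f = fun y => y 0 z * partial p f y by rewrite hframe.unlock.
rewrite (frameE i (frame j f)) (frameE j (frame i f)) !fE.
rewrite !(partialM _ sc) ?partial_coord //; try exact: smooth_partial.
rewrite (partialC Uo i j sf Ux) (eq_sym z i) (eq_sym z j).
by move: (partial j f x) (partial i f x) (partial i _ x) => u v w; ring.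
Qed.

(** * Covariant derivatives in the frame and Codazzi's equation *)

Section Tensors.
Variable b : 'I_n -> 'rV[R]_n -> R.
Hypothesis sb : forall i, smooth U (b i).

(* Here [b] is a 1-form in the orthonormal frame, and [hess], [dhess] are the
   frame components of its first and second covariant derivatives; the
   connection is given by nabla_(E_l) E_j = delta_lj E_z - delta_jz E_l. *)
Definition hess l j x : R :=
  frame l (b j) x - (l == j)%:R * b z x + (j == z)%:R * b l x.

Definition dhess l i j x : R :=
  frame l (hess i j) x
  - ((l == i)%:R * hess z j x - (i == z)%:R * hess l j x)
  - ((l == j)%:R * hess i z x - (j == z)%:R * hess i l x).

Lemma smooth_hess l j : smooth U (hess l j).
Proof.
apply: smoothD => //; last by apply: smoothM => //; exact: smooth_cst.
apply: smoothB => //; first exact: smooth_frame.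
by apply: smoothM => //; exact: smooth_cst.
Qed.

Hint Resolve smooth_hess sb : core.

Ltac smooth_tac := repeat first [ exact: Uo | exact: sb | exact: smooth_hess
  | exact: smooth_cst | apply: smooth_frame | apply: smoothB | apply: smoothD
  | apply: smoothM | assumption ].

(** The commutator of two covariant derivatives of [b]; the right-hand side is the curvature term
    for sectional curvature -1. *)
Lemma codazzi i j k x : (forall l m, hess l m x = hess m l x) -> U x ->
  dhess i j k x - dhess j i k x
  = b i x * (j == k)%:R - b j x * (i == k)%:R.
Proof.
move=> hs Ux.
have fh p q r : frame p (hess q r) x = frame p (frame q (b r)) x
    - (q == r)%:R * frame p (b z) x + (r == z)%:R * frame p (b q) x.
  rewrite /hess frameD //; try by smooth_tac.
  rewrite frameB //; try by smooth_tac.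
  by rewrite !frameZ.
have br := frame_bracket i j (sb k) Ux.
have hij := hs i j; rewrite /hess (eq_sym j i) in hij.
rewrite /dhess !fh (hs j i) /hess eqxx (eq_sym j i) mulr1n.
have {}br : frame i (frame j (b k)) x = frame j (frame i (b k)) x
   + ((i == z)%:R * frame j (b k) x - (j == z)%:R * frame i (b k) x) by lra.
have {}hij : frame i (b j) x
    = frame j (b i) x + (i == z)%:R * b j x - (j == z)%:R * b i x by lra.
by rewrite br hij; ring.
Qed.

(** * Closed and coclosed forms of constant length *)

Section ConstantLength.
Variable k : R.
Hypothesis hess_sym : forall x, U x -> forall i j, hess i j x = hess j i x.
Hypothesis hess_tr : forall x, U x -> \sum_i hess i i x = 0.
Hypothesis norm_b : forall x, U x -> \sum_i b i x * b i x = k.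

Lemma hess_b i x : U x -> \sum_j hess i j x * b j x = 0.
Proof.
move=> Ux.
have : frame i (fun y => \sum_j b j y * b j y) x = 0.
  by rewrite (frame_eq_on i norm_b Ux) frame_cst.
rewrite frame_sum //; last by move=> j; smooth_tac.
under eq_bigr do rewrite frameM //.
move=> E.
(* The connection is metric: its terms contribute [- b_z b_i + b_i b_z = 0]. *)
transitivity (2^-1 * \sum_j (b j x * frame i (b j) x + b j x * frame i (b j) x)
   - b z x * (\sum_j (i == j)%:R * b j x) + b i x * \sum_j (z == j)%:R * b j x).
  rewrite !mulr_sumr -sumrB -big_split /=; apply: eq_bigr => j _.
  by rewrite /hess (eq_sym z j); field.
by rewrite E !sum_delta; ring.
Qed.

(** The covariant derivative of [B b = 0]. *)
Lemma dhess_b l i x : U x ->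
  \sum_j dhess l i j x * b j x = - \sum_j hess i j x * hess l j x.
Proof.
move=> Ux.
have : frame l (fun y => \sum_j hess i j y * b j y) x = 0.
  by rewrite (@frame_eq_on l _ _ _ (hess_b i) Ux) frame_cst.
rewrite frame_sum //; last by move=> j; smooth_tac.
under eq_bigr do rewrite frameM //.
move=> E; apply/eqP; rewrite -addr_eq0; apply/eqP; rewrite -[RHS]E.
(* Of the connection terms, those containing [B b] vanish and the others cancel in pairs. *)
transitivity (\sum_j (hess i j x * frame l (b j) x + b j x * frame l (hess i j) x)
  - (l == i)%:R * (\sum_j hess z j x * b j x)
  + (i == z)%:R * (\sum_j hess l j x * b j x)
  - (hess i z x) * (\sum_j (l == j)%:R * b j x)
  + (hess i l x) * (\sum_j (z == j)%:R * b j x)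
  - b z x * (\sum_j (l == j)%:R * hess i j x)
  + b l x * (\sum_j (z == j)%:R * hess i j x)).
  rewrite !mulr_sumr -!sumrN -!big_split /=; apply: eq_bigr => j _.
  by rewrite /dhess [hess l j x in X in _ + X]/hess (eq_sym z j); ring.
by rewrite !hess_b // !sum_delta; ring.
Qed.

Lemma dhess_sym l i j x : U x -> dhess l i j x = dhess l j i x.
Proof.
move=> Ux; have hs := hess_sym Ux.
rewrite /dhess (@frame_eq_on l (hess i j) (hess j i)) //; last first.
  by move=> y Uy; exact: hess_sym.
by rewrite (hs z j) (hs l j) (hs i z) (hs i l); ring.
Qed.

Lemma dhess_tr l x : U x -> \sum_j dhess l j j x = 0.
Proof.
move=> Ux; have hs := hess_sym Ux.
have : frame l (fun y => \sum_j hess j j y) x = 0.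
  by rewrite (frame_eq_on l hess_tr Ux) frame_cst.
rewrite frame_sum // => E.
transitivity (\sum_j frame l (hess j j) x
  - 2 * (\sum_j (l == j)%:R * hess j z x) + 2 * (\sum_j (z == j)%:R * hess j l x)).
  rewrite !mulr_sumr -sumrB -big_split /=; apply: eq_bigr => j _.
  by rewrite /dhess (hs z j) (hs l j) (eq_sym z j); ring.
by rewrite E !sum_delta (hs l z); ring.
Qed.

(* Bochner's formula for a harmonic form of constant length, with Ric = -(n-1). *)
Lemma hess_norm x : U x -> \sum_i \sum_j hess i j x * hess i j x = (n%:R - 1) * k.
Proof.
move=> Ux; have hs := hess_sym Ux.
transitivity (- \sum_i \sum_j dhess i i j x * b j x).
  rewrite -sumrN; apply: eq_bigr => i _; by rewrite dhess_b // opprK.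
rewrite exchange_big -(norm_b Ux) mulr_sumr -sumrN; apply: eq_bigr => j _.
rewrite -mulr_suml -mulNr mulrA; congr (_ * _).
(* Codazzi's equation turns the divergence of [B] into the derivative of its trace, which is 0, plus
   the Ricci term [b_j - n b_j]. *)
transitivity (- (\sum_i dhess j i i x + \sum_i (j == i)%:R * b i x - \sum_(i < n) b j x)).
  rewrite -big_split -sumrB; congr (- _); apply: eq_bigr => i _ /=.
  have := codazzi i j i hs Ux; rewrite eqxx mulr1 (dhess_sym i i j) //; lra.
by rewrite dhess_tr // sum_delta sumr_const card_ord -mulr_natl; ring.
Qed.

(** * The first-order system for (b, B) and its integrability condition *)

Section Rigid.
Hypothesis k0 : k != 0.
Hypothesis hess2 : forall x, U x -> forall i j,
  \sum_l hess i l x * hess l j x = k * (i == j)%:R - b i x * b j x.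

(** The covariant derivative of [B^2 = k Id - b b^T]; the identity tensor is parallel. *)
Lemma dhess_hess l i j x : U x ->
  \sum_p (dhess l i p x * hess p j x + hess i p x * dhess l p j x)
  = - (hess l i x * b j x + b i x * hess l j x).
Proof.
move=> Ux; have hs := hess_sym Ux.
have : frame l (fun y => \sum_p hess i p y * hess p j y) x
     = - (b i x * frame l (b j) x + b j x * frame l (b i) x).
  rewrite (@frame_eq_on l _ (fun y => k * (i == j)%:R - b i y * b j y)) //; last first.
    by move=> y Uy; exact: hess2.
  rewrite frameB ?frame_cst ?frameM ?sub0r //; smooth_tac.
rewrite frame_sum //; last by move=> p; smooth_tac.
under eq_bigr do rewrite frameM //.
move=> E.
transitivity (
  \sum_p (hess i p x * frame l (hess p j) x + hess p j x * frame l (hess i p) x)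
  - (l == i)%:R * (\sum_p hess z p x * hess p j x)
  + (i == z)%:R * (\sum_p hess l p x * hess p j x)
  - hess i z x * (\sum_p (l == p)%:R * hess p j x)
  + hess i l x * (\sum_p (z == p)%:R * hess p j x)
  - hess z j x * (\sum_p (l == p)%:R * hess i p x)
  + hess l j x * (\sum_p (z == p)%:R * hess i p x)
  - (l == j)%:R * (\sum_p hess i p x * hess p z x)
  + (j == z)%:R * (\sum_p hess i p x * hess p l x)).
  rewrite !mulr_sumr -!sumrN -!big_split /=; apply: eq_bigr => p _.
  by rewrite /dhess (eq_sym z p); ring.
by rewrite E !hess2 // !sum_delta /hess (eq_sym z j) (eq_sym i l); ring.
Qed.

(** [hessian_derivativeE] solved for the frame derivative of [B]. Together with the definition of
    [hess] it expresses all first derivatives of [b] and [B] through [b] and [B]. *)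
Lemma frame_hess l i j x : U x ->
  k * frame l (hess i j) x = 2 * b l x * b i x * b j x
    - k * (l == i)%:R * b j x - k * (l == j)%:R * b i x
    + k * (l == i)%:R * hess z j x - k * (i == z)%:R * hess l j x
    + k * (l == j)%:R * hess i z x - k * (j == z)%:R * hess i l x.
Proof.
move=> Ux.
have := @hessian_derivativeE R n k (b^~ x) (fun i j => hess i j x)
  (fun l i j => dhess l i j x) k0 (hess_sym Ux) (fun i => hess_b i Ux) (norm_b Ux)
  (hess2 Ux) (fun l i j => dhess_sym l i j Ux)
  (fun l i j => codazzi l i j (hess_sym Ux) Ux) (fun l i => dhess_b l i Ux)
  (fun l i j => dhess_hess l i j Ux) l i j.
by rewrite /dhess; lra.
Qed.

(** The commutator of covariant derivatives of [B] is computed once from curvature and once by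
    differentiating the formula for [dhess]. The Kronecker terms occur in both with opposite signs,
    so they add up, and a common factor 2 cancels. *)
Lemma ricci_identity l m i j x : U x ->
  k * (hess m j x * (l == i)%:R - hess l j x * (m == i)%:R
       + hess i m x * (l == j)%:R - hess i l x * (m == j)%:R)
  = (b l x * hess m i x - b m x * hess l i x) * b j x
    + b i x * (b l x * hess m j x - b m x * hess l j x).
Proof.
move=> Ux; have hs := hess_sym Ux.
(* The factor [k] stays attached to each first derivative of [B], so that [frame_hess] applies a
   second time. *)
have ff p q : k * frame p (frame q (hess i j)) x =
   2 * (frame p (b q) x * b i x * b j x + b q x * frame p (b i) x * b j x
      + b q x * b i x * frame p (b j) x)
    - k * (q == i)%:R * frame p (b j) x - k * (q == j)%:R * frame p (b i) x
    + (q == i)%:R * (k * frame p (hess z j) x) - (i == z)%:R * (k * frame p (hess q j) x)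
    + (q == j)%:R * (k * frame p (hess i z) x) - (j == z)%:R * (k * frame p (hess i q) x).
  rewrite -frameZ //; last by smooth_tac.
  rewrite (@frame_eq_on p _ _ _ (frame_hess q i j) Ux).
  rewrite !(frameB, frameD, frameM, frame_cst) //; smooth_tac.
  ring.
have fb p q : frame p (b q) x = hess p q x + (p == q)%:R * b z x - (q == z)%:R * b p x.
  by rewrite /hess; ring.
have br : k * frame l (frame m (hess i j)) x - k * frame m (frame l (hess i j)) x
  = (l == z)%:R * (k * frame m (hess i j) x) - (m == z)%:R * (k * frame l (hess i j) x).
  by rewrite -mulrBr frame_bracket //; ring.
move: br; rewrite !ff !frame_hess // !fb eqxx mulr1n.
rewrite ?(eq_sym m l) ?(eq_sym z i) ?(eq_sym z j) ?(hs m l)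
  ?(hs z i) ?(hs z j) ?(hs z l) ?(hs z m) ?(hs i m) ?(hs i l) => br.
lra.
Qed.

(* Contracting the two sides of [ricci_identity] over l = i gives
   n * hess and hess respectively. *)
Lemma hess_eq0 m j x : (1 < n)%N -> U x -> hess m j x = 0.
Proof.
move=> n1 Ux; have hs := hess_sym Ux.
have E1 : \sum_l k * (hess m j x * (l == l)%:R - hess l j x * (m == l)%:R
       + hess l m x * (l == j)%:R - hess l l x * (m == j)%:R) = k * (n%:R * hess m j x).
  rewrite -mulr_sumr; congr (_ * _).
  transitivity (\sum_(l < n) hess m j x - \sum_l (m == l)%:R * hess l j x
     + \sum_l (j == l)%:R * hess l m x - (\sum_l hess l l x) * (m == j)%:R).
    rewrite mulr_suml -!sumrN -!big_split /=; apply: eq_bigr => l _.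
    by rewrite eqxx (eq_sym l j) mulr1n; ring.
  by rewrite !sum_delta hess_tr // sumr_const card_ord -mulr_natl (hs j m); ring.
have E2 : \sum_l ((b l x * hess m l x - b m x * hess l l x) * b j x
    + b l x * (b l x * hess m j x - b m x * hess l j x)) = k * hess m j x.
  transitivity (b j x * (\sum_l hess m l x * b l x) - b m x * b j x * (\sum_l hess l l x)
     + (\sum_l b l x * b l x) * hess m j x - b m x * (\sum_l hess j l x * b l x)).
    rewrite mulr_suml !mulr_sumr -!sumrN -!big_split /=; apply: eq_bigr => l _.
    by rewrite (hs j l); ring.
  by rewrite !hess_b // hess_tr // norm_b //; ring.
have : k * (n%:R * hess m j x) = k * hess m j x.
  rewrite -E1 -E2; apply: eq_bigr => l _; exact: ricci_identity.
move/(mulfI k0)/eqP; rewrite -subr_eq0 -[X in _ - X]mul1r -mulrBl mulf_eq0.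
by rewrite subr_eq0 pnatr_eq1 gtn_eqF //= => /eqP.
Qed.

End Rigid.
End ConstantLength.
End Tensors.
End HalfSpaceFrame.

(** If [k] were nonzero, integrability would force [B = 0], against [|B|^2 = 2 k]. Dimension 3
    enters through the formula for [B^2]. *)
Lemma half_space_rigidity (R : realType) (U : set 'rV[R]_3) (z : 'I_3)
    (b : 'I_3 -> 'rV[R]_3 -> R) (k : R) : open U -> U !=set0 ->
  (forall i, smooth U (b i)) ->
  (forall x, U x -> forall i j, hess z b i j x = hess z b j i x) ->
  (forall x, U x -> \sum_i hess z b i i x = 0) ->
  (forall x, U x -> \sum_i b i x * b i x = k) -> k = 0.
Proof.
move=> Uo [x Ux] sb hs ht hn; apply/eqP/negPn/negP => k0.
have bochner y : U y -> \sum_i \sum_j hess z b i j y * hess z b i j y = 2 * k.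
  by move=> Uy; rewrite (hess_norm Uo sb hs ht hn Uy); ring.
have h2 y : U y -> forall i j, \sum_l hess z b i l y * hess z b l j y
    = k * (i == j)%:R - b i y * b j y.
  move=> Uy; apply: (@traceless_sqr_mx3 R k (b^~ y) (fun i j => hess z b i j y));
    [exact: hs|exact: ht| |exact: hn|exact: bochner].
  by move=> i; exact: (hess_b z Uo sb hn i Uy).
have := bochner x Ux; rewrite big1 => [|i _]; last first.
  rewrite big1 // => j _.
  by rewrite (hess_eq0 Uo sb hs ht hn k0 h2) ?mul0r.
by move/esym/eqP; rewrite mulf_eq0 (negbTE k0) pnatr_eq0.
Qed.

(** * Hyperbolic charts *)

Lemma partial_inv_coordM (R : realType) n (z i : 'I_n) (f : 'rV[R]_n -> R)
    (x : 'rV[R]_n) : x 0 z != 0 -> derivable f x (delta_mx 0 i) ->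
  partial i (fun y => (y 0 z)^-1 * f y) x
  = (x 0 z)^-1 * partial i f x - (x 0 z) ^- 2 * ((z == i)%:R * f x).
Proof.
move=> z0 df.
have [dz zE] := is_derive_coord z x (delta_mx 0 i).
apply: etrans (deriveM (derivableV z0 dz) df) _.
rewrite (deriveV z0 dz) zE mxE eqxx /= /partial.
by rewrite /GRing.scale /=; move: ('D__ _ _) => u; ring.
Qed.

(** Passage from coordinate components [a] to orthonormal ones [b = x_z a]. The weight [x_z^-1] in
    the divergence is the volume density [x_z^-3] times the inverse metric [x_z^2]. *)
Lemma half_space_conformal (R : realType) (U : set 'rV[R]_3) (z : 'I_3)
    (a : 'I_3 -> 'rV[R]_3 -> R) (k : R) : open U -> U !=set0 ->
  (forall x, U x -> 0 < x 0 z) -> (forall i, smooth U (a i)) ->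
  (forall x, U x -> forall i j, partial i (a j) x = partial j (a i) x) ->
  (forall x, U x -> \sum_i partial i (fun y => (y 0 z)^-1 * a i y) x = 0) ->
  (forall x, U x -> x 0 z ^+ 2 * (\sum_i a i x * a i x) = k) -> k = 0.
Proof.
move=> Uo U0 zpos sa closed coclosed norm.
pose b (i : 'I_3) (x : 'rV[R]_3) := x 0 z * a i x.
have sz := smooth_coord Uo z.
have sb i : smooth U (b i) by exact: smoothM.
(* All terms but the first are visibly symmetric, so closedness of [a] amounts to symmetry of
   [hess]. *)
have hessE x l j : U x -> hess z b l j x = x 0 z ^+ 2 * partial l (a j) x
    + (l == z)%:R * b j x + (j == z)%:R * b l x - (l == j)%:R * b z x.
  move=> Ux; rewrite /hess frameE (partialM l sz (sa j) Ux) partial_coord (eq_sym z) /b.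
  by move: (partial _ _ _) => u; ring.
have div x : U x -> \sum_i partial i (a i) x = (x 0 z)^-1 * a z x.
  move=> Ux; have z0 : x 0 z != 0 by rewrite gt_eqF ?zpos.
  have E : \sum_i partial i (fun y => (y 0 z)^-1 * a i y) x =
      (x 0 z)^-1 * (\sum_i partial i (a i) x)
      - (x 0 z) ^- 2 * \sum_i (z == i)%:R * a i x.
    rewrite !mulr_sumr -sumrB; apply: eq_bigr => i _.
    by rewrite (partial_inv_coordM z0 (smooth_derivable (sa i) Ux)); ring.
  have := coclosed x Ux; rewrite E sum_delta => /eqP; rewrite subr_eq0 => /eqP {}E.
  by rewrite -[LHS](mulVKf z0) E; field.
apply: (half_space_rigidity (z := z) Uo U0 sb).
- move=> x Ux i j; rewrite !hessE // (closed x Ux i j) (eq_sym i j).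
  by move: (partial _ _ _) => u; ring.
(* By [div] the trace is [b_z + 2 b_z - 3 b_z = 0]. *)
- move=> x Ux; have z0 : x 0 z != 0 by rewrite gt_eqF ?zpos.
  transitivity (x 0 z ^+ 2 * (\sum_i partial i (a i) x)
     + 2 * (\sum_i (z == i)%:R * b i x) - \sum_(i < 3) b z x).
    rewrite !mulr_sumr -sumrN -!big_split /=; apply: eq_bigr => i _.
    rewrite hessE // eqxx (eq_sym z) mulr1n.
    by move: (partial _ _ _) => u; ring.
  rewrite div // sum_delta sumr_const card_ord -mulr_natl /b.
  by field.
- move=> x Ux; rewrite -(norm x Ux) mulr_sumr; apply: eq_bigr => i _.
  by rewrite /b; ring.
Qed.

Section HyperbolicChart.
Variables (R : realType) (M : oriented_manifold R 3).
Variables (g : riemannian_metric M) (alpha : one_form M) (c : chart R 3 M).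
Hypothesis c_atlas : atlas c.
Hypothesis c_half : cran c `<=` @half_space R 2.
Hypothesis c_isom : forall q, cdom c q -> metric_at g c q = half_space_metric (c q).

Lemma cran_cdom x : cran c x -> cdom c (cinv c x) /\ c (cinv c x) = x.
Proof. by move=> [q qd <-]; rewrite cfunK ?inE. Qed.

Lemma metric_half_space x : cran c x ->
  in_coord c (metric_at g c) x = half_space_metric x.
Proof. by move=> /cran_cdom[xd {2}<-]; exact: c_isom. Qed.

Lemma codiff_half_space x : cran c x ->
  codiff g alpha c x = - (x 0 ord_max ^+ 3 * \sum_i partial i
    (fun y => (y 0 ord_max)^-1 * in_coord c (form_at alpha c) y i 0) x).
Proof.
move=> Ux.
have sqrtE y : cran c y ->
    Num.sqrt (\det (in_coord c (metric_at g c) y)) = (y 0 ord_max) ^- 3.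
  move=> Uy; have y0 : 0 < y 0 ord_max by exact: c_half.
  rewrite metric_half_space // det_scalar.
  (* The determinant is written as a square, whose root is fixed by the positivity of the height. *)
  have -> : (y 0 ord_max ^- 2) ^+ 3 = ((y 0 ord_max) ^- 3) ^+ 2.
    by rewrite -!exprVn -!exprM.
  by rewrite sqrtr_sqr ger0_norm // invr_ge0 exprn_ge0 // ltW.
rewrite /codiff sqrtE // invrK; congr (- (_ * _)); apply: eq_bigr => i _.
apply: partial_eq_on (Ux) => [|y Uy]; first exact: cran_open.
have y0 : 0 < y 0 ord_max by exact: c_half.
rewrite sqrtE // metric_half_space // /half_space_metric invmx_scalar mul_scalar_mx mxE.
by field; rewrite gt_eqF.
Qed.

Lemma norm_half_space x : cran c x ->
  pointwise_norm g alpha c (cinv c x) ^+ 2 = x 0 ord_max ^+ 2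
    * \sum_i in_coord c (form_at alpha c) x i 0 * in_coord c (form_at alpha c) x i 0.
Proof.
move=> Ux; rewrite /pointwise_norm.
rewrite -/(in_coord c (metric_at g c) x) metric_half_space // /half_space_metric.
rewrite invmx_scalar invrK mul_mx_scalar -scalemxAl. rewrite 2!mxE.
under eq_bigr do rewrite mxE.
rewrite sqr_sqrtr // mulr_ge0 // ?sqr_ge0 //.
by apply: sumr_ge0 => i _; rewrite -expr2 sqr_ge0.
Qed.

End HyperbolicChart.

Theorem proposition5p2p1 (R : realType) (M : oriented_manifold R 3)
    (g : riemannian_metric M) (alpha : one_form M) :
  closed_manifold M -> hyperbolic g ->
  harmonic g alpha -> nontrivial alpha ->
  ~ constant_length g alpha.
Proof.
move=> _ hyp harm [c0 [p [c0a c0p ap]]] [k len].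
(* A hyperbolic chart around the very point where [alpha] is nonzero. *)
have [c [ca cp chalf cisom]] := hyp p.
pose a (i : 'I_3) x := in_coord c (form_at alpha c) x i 0.
have Uo : open (cran c) by exact: cran_open.
have Up : cran c (c p) by exists p.
have norm x : cran c x -> x 0 ord_max ^+ 2 * (\sum_i a i x * a i x) = k ^+ 2.
  move=> Ux; rewrite -(norm_half_space alpha cisom Ux) len //.
  by have [] := cran_cdom Ux.
have k0 : k ^+ 2 = 0.
  apply: (half_space_conformal (z := ord_max) (a := a) Uo _ _ _ _ _ norm).
  - by exists (c p).
  - by move=> x /chalf.
  - exact: form_smooth.
  - move=> x Ux i j; have [/(_ i j) E _] := harm c ca x Ux.
    by apply/eqP; rewrite -subr_eq0; apply/eqP.
  - move=> x Ux; have [_] := harm c ca x Ux.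
    rewrite (codiff_half_space alpha chalf cisom Ux) => /eqP.
    rewrite oppr_eq0 mulf_eq0 expf_eq0 /= gt_eqF; last exact: chalf.
    by move=> /eqP.
(* The length being 0, the sum of squares vanishes at [p]. Hence all components there vanish in [c],
   and by the transformation law also in [c0]. *)
have := norm _ Up; rewrite k0 => /eqP.
rewrite mulf_eq0 expf_eq0 /= gt_eqF /=; last exact: chalf.
rewrite psumr_eq0 => [/allP ai0|i _]; last by rewrite -expr2 sqr_ge0.
move/eqP: ap; apply.
rewrite (form_transform alpha c0a ca c0p cp).
rewrite (_ : form_at alpha c p = 0) ?mulmx0 //.
apply/matrixP => i j; rewrite ord1 mxE.
have := ai0 i; rewrite mem_index_enum => /(_ isT).
by rewrite /= mulf_eq0 orbb /a /in_coord cfunK ?inE // => /eqP.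
Qed.
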